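(* Up to isomorphism, the two-dimensional endo-commutative curled algebras over $\mathbb F_2$ are exactly classified into the eight algebras $ECC^2_0, ECC^2_1, ECC^2_2, ECC^2_3, ECC^2_4, ECC^2_5, ECC^2_6, ECC^2_7$ whose multiplication tables on a linear base $\{e,f\}$ are, respectively, $$\begin{pmatrix}0&0\\ 0&0\end{pmatrix},\ \begin{pmatrix}0&f\\ f&0\end{pmatrix},\ \begin{pmatrix}0&f\\ e&0\end{pmatrix},\ \begin{pmatrix}0&e\\ f&0\end{pmatrix},\ \begin{pmatrix}e&f\\ 0&0\end{pmatrix},\ \begin{pmatrix}e&0\\ f&0\end{pmatrix},\ \begin{pmatrix}e&0\\ 0&f\end{pmatrix},\ \begin{pmatrix}e&e+f\\ e+f&f\end{pmatrix}.$$ That is, each of these eight algebras is endo-commutative and curled, no two of them are isomorphic, and every two-dimensional endo-commutative curled algebra over $\mathbb F_2$ is isomorphic to one of them.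
   Context: An algebra over the two-element field $\mathbb F_2$ is an $\mathbb F_2$-vector space with a bilinear multiplication, not assumed associative, commutative or unital. An algebra $A$ is endo-commutative if $x^2y^2=(xy)^2$ for all $x,y\in A$. A two-dimensional algebra is curled if, for every element $x$, the square $x^2$ is a scalar multiple of $x$. The multiplication table of an algebra on a linear base $\{e,f\}$ is the array $\begin{pmatrix}e^2&ef\\ fe&f^2\end{pmatrix}$. *)

(* Defs.v *)
From HB Require Import structures.
From mathcomp Require Import all_boot all_order all_algebra.

Set Implicit Arguments.
Unset Strict Implicit.
Unset Printing Implicit Defensive.

Import GRing.Theory.
Local Open Scope ring_scope.

(* Finite-dimensional algebras that need not be associative, commutative or
   unital, hence not MathComp's algType or falgType. *)
Record nalgebra (K : fieldType) := NAlgebra {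
  carrier :> vectType K;
  amul : {bilinear carrier -> carrier -> carrier}
}.

Notation "x ** y" := (amul _ x y) (at level 40, left associativity).

Definition endo_commutative (K : fieldType) (A : nalgebra K) : Prop :=
  forall x y : A, (x ** x) ** (y ** y) = (x ** y) ** (x ** y).

Definition curled (K : fieldType) (A : nalgebra K) : Prop :=
  forall x : A, exists k : K, x ** x = k *: x.

Definition isomorphic (K : fieldType) (A B : nalgebra K) : Prop :=
  exists2 phi : {linear A -> B},
    bijective phi & forall x y : A, phi (x ** y) = phi x ** phi y.

Section TableAlgebra.
Variables (K : fieldType) (n : nat) (T : 'M['rV[K]_n]_n).

(* The bilinear extension of delta_mx 0 i, delta_mx 0 j |-> T i j. *)
Definition table_mul (x y : 'rV[K]_n) : 'rV[K]_n :=
  \sum_i \sum_j (x 0 i * y 0 j) *: T i j.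

Fact table_mul_is_bilinear : bilinear_for *:%R *:%R table_mul.
Proof.
split=> [y a x x' | x a y y'] /=; rewrite /table_mul scaler_sumr -big_split /=;
  apply: eq_bigr => i _; rewrite scaler_sumr -big_split /=; apply: eq_bigr => j _;
  rewrite scalerA -scalerDl !mxE.
- by rewrite mulrDl mulrA.
- by rewrite mulrDr mulrCA.
Qed.

HB.instance Definition _ :=
  bilinear_isBilinear.Build K 'rV[K]_n 'rV[K]_n 'rV[K]_n *:%R *:%R
    table_mul table_mul_is_bilinear.

Definition table_algebra : nalgebra K := @NAlgebra K 'rV[K]_n table_mul.

Fact table_algebraE (i j : 'I_n) :
  (delta_mx 0 i : table_algebra) ** delta_mx 0 j = T i j.
Proof.
rewrite /= /table_mul (bigD1 i) //= (bigD1 j) //= !mxE !eqxx mulr1 scale1r.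
rewrite [X in _ + X + _]big1 ?addr0 => [|j' /negPf ne].
  rewrite big1 ?addr0 // => i' /negPf ne.
  by rewrite big1 // => j' _; rewrite !mxE ne andbF mul0r scale0r.
by rewrite !mxE ne andbF mulr0 scale0r.
Qed.

End TableAlgebra.

(* The array ((a, b), (c, d)), read as e^2 = a, ef = b, fe = c, f^2 = d. *)
Definition table2 (V : nmodType) (a b c d : V) : 'M[V]_2 :=
  \matrix_(i, j) if i == 0 then (if j == 0 then a else b)
                 else (if j == 0 then c else d).

Definition ECC_tables : 8.-tuple 'M['rV['F_2]_2]_2 :=
  let e := delta_mx 0 0 in
  let f := delta_mx 0 1 in
  [tuple table2 0 0 0 0;
         table2 0 f f 0;
         table2 0 f e 0;
         table2 0 e f 0;
         table2 e f 0 0;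
         table2 e 0 f 0;
         table2 e 0 0 f;
         table2 e (e + f) (e + f) f].

Definition ECC (i : 'I_8) : nalgebra 'F_2 := table_algebra (tnth ECC_tables i).

(* Main.v *)
Require Import Defs.
From HB Require Import structures.
From mathcomp Require Import all_boot all_order all_algebra.

Set Implicit Arguments.
Unset Strict Implicit.
Unset Printing Implicit Defensive.

Import GRing.Theory.
Local Open Scope ring_scope.

(** Over 'F_2 a curled algebra is one in which every x is either an idempotent
    or has square zero. A plane over 'F_2 has just three nonzero vectors
    u, v, u + v, any two of which form a basis, and polarization gives
      u v + v u = (u + v)^2 + u^2 + v^2,
    so the algebra is determined by its idempotents and the single product
    u v, which has four possible values. After a permutation of the three
    vectors, only the number of idempotents among them matters:
    - none: the product is alternating, hence zero (ECC 0) or, with its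
      nonzero value taken as second basis vector, ECC 1;
    - only u + v: endo-commutativity gives 0 = u^2 v^2 = (u v)^2 and likewise
      (v u)^2 = 0, which leaves u v = v (ECC 2) and u v = u (ECC 3);
    - u and u + v: again (u v)^2 = 0, so u v = v (ECC 4) or u v = 0 (ECC 5);
    - all three: the product is commutative; if u v = u + v this is ECC 7, and
      otherwise two of the three vectors annihilate each other (ECC 6).

    The eight algebras are told apart by two numbers that an isomorphism
    preserves, those of pairs (x, y) with x y = y and with x y = x:
      (4,4), (6,6), (9,5), (5,9), (10,6), (6,10), (9,9), (7,7).

    The statements about the concrete algebras are finite checks. Vectors of a
    plane with basis (u, v) are coded by pairs of booleans through [comb], and
    [comb_mul] turns the product into a boolean function that computes;
    [comb_inj] and [comb_surj] say that nothing is lost in the coding. *)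

(** * Algebras given by a multiplication table *)

Section TableIsomorphism.

Variables (K : fieldType) (A : nalgebra K) (n : nat).
Variables (X : n.-tuple A) (T : 'M['rV[K]_n]_n).
Hypotheses (basisX : basis_of fullv X)
  (tableX : forall i j : 'I_n, X`_i ** X`_j = \sum_k T i j 0 k *: X`_k).

Let coords (x : A) : table_algebra T := \row_i coord X i x.

Fact coords_is_linear : linear coords.
Proof. by move=> a x y; apply/rowP=> i; rewrite !mxE linearP. Qed.

HB.instance Definition _ := GRing.isLinear.Build K A (table_algebra T) _ coords
  coords_is_linear.

Let coordsK : cancel coords (fun w : 'rV[K]_n => \sum_i w 0 i *: X`_i).
Proof.
move=> x; rewrite [RHS](coord_basis basisX (memvf x)).
by apply: eq_bigr => i _; rewrite mxE.
Qed.

(** The coordinate map in a basis is an isomorphism onto the algebra of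
    structure constants: both products are bilinear, so it is enough that they
    agree on the basis. *)
Lemma isomorphic_table_algebra : isomorphic A (table_algebra T).
Proof.
exists coords.
  exists (fun w : 'rV[K]_n => \sum_i w 0 i *: X`_i) => // w; apply/rowP=> i.
  by rewrite mxE coord_sum_free ?(basis_free basisX).
move=> x y; rewrite -{1}[x]coordsK -{1}[y]coordsK.
rewrite linear_sumlz !linear_sum /= /table_mul.
apply: eq_bigr => i _; rewrite linear_sumr !linear_sum.
apply: eq_bigr => j _; rewrite linearZl_LR linearZr_LR !linearZ /= scalerA.
congr (_ *: _); apply/rowP=> k.
by rewrite mxE tableX coord_sum_free ?(basis_free basisX).
Qed.

End TableIsomorphism.

(** * Boolean coordinates in planes over the two-element field *)

Lemma F2_cases (k : 'F_2) : k = 0 \/ k = 1.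
Proof.
by case: k => [[|[|//]]] lt_k; [left | right]; apply: val_inj.
Qed.

(** Booleans rather than elements of 'F_2 serve as coordinates because closed
    expressions in them reduce. *)
Definition comb (V : zmodType) (u v : V) (p : bool * bool) : V :=
  u *+ p.1 + v *+ p.2.

Definition bits_add (p q : bool * bool) : bool * bool :=
  (p.1 (+) q.1, p.2 (+) q.2).

Definition bits_scale (b : bool) (p : bool * bool) : bool * bool :=
  (b && p.1, b && p.2).

(** The four fields are u^2, u v, v u and v^2 in coordinates on (u, v). *)
Record bits_table := BitsTable {
  sq_fst : bool * bool;  prod_fs : bool * bool;
  prod_sf : bool * bool; sq_snd : bool * bool
}.

Definition bits_mul (t : bits_table) (p q : bool * bool) : bool * bool :=
  bits_add
    (bits_add (bits_scale (p.1 && q.1) (sq_fst t))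
              (bits_scale (p.1 && q.2) (prod_fs t)))
    (bits_add (bits_scale (p.2 && q.1) (prod_sf t))
              (bits_scale (p.2 && q.2) (sq_snd t))).

Definition has_table (A : nalgebra 'F_2) (u v : A) (t : bits_table) : Prop :=
  [/\ u ** u = comb u v (sq_fst t), u ** v = comb u v (prod_fs t),
      v ** u = comb u v (prod_sf t) & v ** v = comb u v (sq_snd t)].

Definition ECC_bits (i : nat) : bits_table :=
  let o := (false, false) in
  let e := (true, false) in
  let f := (false, true) in
  let g := (true, true) in
  nth (BitsTable o o o o)
    [:: BitsTable o o o o; BitsTable o f f o; BitsTable o f e o;
        BitsTable o e f o; BitsTable e f o o; BitsTable e o f o;
        BitsTable e o o f; BitsTable e g g f] i.

Section CharTwo.

Variable V : lmodType 'F_2.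

Lemma addvv (x : V) : x + x = 0.
Proof.
by rewrite -mulr2n -scaler_nat (_ : 2%:R = 0) ?scale0r //; apply: val_inj.
Qed.

Lemma addKv (x y : V) : x + (x + y) = y.
Proof. by rewrite addrA addvv add0r. Qed.

Lemma mulrb_addb (x : V) (b c : bool) : x *+ b + x *+ c = x *+ (b (+) c).
Proof. by case: b; case: c; rewrite /= ?addr0 ?add0r ?addvv. Qed.

Lemma comb_add (u v : V) p q :
  comb u v p + comb u v q = comb u v (bits_add p q).
Proof. by rewrite /comb addrACA !mulrb_addb. Qed.

Lemma comb_scale (u v : V) p (b : bool) :
  comb u v p *+ b = comb u v (bits_scale b p).
Proof. by rewrite /comb; case: b; rewrite //= addr0. Qed.

(** The three vectors are all the nontrivial combinations of u and v, so this is
    linear independence; in this form its symmetry under the permutations of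
    u, v, u + v is plain. *)
Definition independent (u v : V) := [/\ u != 0, v != 0 & u + v != 0].

Lemma independent_swap u v : independent u v -> independent v u.
Proof. by case=> u0 v0 uv0; split; rewrite // addrC. Qed.

Lemma independent_add u v : independent u v -> independent u (u + v).
Proof. by case=> u0 v0 uv0; split; rewrite // addKv. Qed.

Lemma comb_inj u v : independent u v -> injective (comb u v).
Proof.
case=> u0 v0 uv0 p q eq_pq.
(* In characteristic 2 the difference of p and q is their sum, and it has to be
   one of the combinations u, v, u + v unless p = q. *)
have: comb u v (bits_add p q) = 0 by rewrite -comb_add eq_pq addvv.
case: p q {eq_pq} => [[] []] [[] []]; rewrite /comb //= ?addr0 ?add0r => /eqP;
by rewrite ?(negPf u0) ?(negPf v0) ?(negPf uv0).
Qed.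

End CharTwo.

Lemma independent_basis (V : vectType 'F_2) (u v : V) :
  \dim {: V} = 2%N -> independent u v -> basis_of fullv [:: u; v].
Proof.
move=> dimV uv_ind; rewrite basisEfree subvf dimV andbT.
apply/(@freeP _ _ _ [tuple u; v]) => k.
rewrite big_ord_recl big_ord1 /= => k_rel i.
have k_comb j : k j *: [tuple u; v]`_j = [tuple u; v]`_j *+ (k j != 0).
  by case: (F2_cases (k j)) => ->; rewrite ?scale0r ?scale1r ?eqxx.
have: comb u v (k ord0 != 0, k (lift ord0 ord0) != 0) = comb u v (false, false).
  by rewrite /comb -(k_comb ord0) -(k_comb (lift ord0 ord0)) addr0.
move/(comb_inj uv_ind) => [/negbFE/eqP k0 /negbFE/eqP k1].
by case: i => [[|[|//]] lt_i]; [rewrite -[RHS]k0 | rewrite -[RHS]k1];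
   congr k; apply: val_inj.
Qed.

Lemma exists_independent (V : vectType 'F_2) :
  \dim {: V} = 2%N -> exists u v : V, independent u v.
Proof.
move=> dimV; have := basis_free (vbasisP {: V}).
have: size (vbasis {: V}) = 2%N by rewrite size_tuple.
case: (tval _) => [|u [|v [|//]]] // _; rewrite free_cons span_seq1.
case/andP=> u_notin; rewrite free_cons span_nil memv0 => /andP[v0 _].
exists u, v; split=> //; first by apply: contraNneq u_notin => ->; apply: mem0v.
apply: contraNneq u_notin => uv0.
by rewrite -(addKv v u) [v + u]addrC uv0 addr0 memv_line.
Qed.

Lemma comb_surj (V : vectType 'F_2) (u v : V) :
  \dim {: V} = 2%N -> independent u v -> forall w, exists p, w = comb u v p.
Proof.
move=> dimV /(independent_basis dimV) uvB w.
have /coord_span -> : w \in <<[tuple u; v]>>%VS.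
  by rewrite (span_basis uvB) memvf.
rewrite big_ord_recl big_ord1 /=; set a := coord _ _ w; set b := coord _ _ w.
exists (a != 0, b != 0); rewrite /comb.
by case: (F2_cases a) => ->; case: (F2_cases b) => ->;
   rewrite ?scale0r ?scale1r ?eqxx.
Qed.

Lemma comb_mul (A : nalgebra 'F_2) (u v : A) t :
  has_table u v t ->
  forall p q, comb u v p ** comb u v q = comb u v (bits_mul t p q).
Proof.
case=> uu uv vu vv p q.
have mulMn (x y : A) (b c : bool) : (x *+ b) ** (y *+ c) = x ** y *+ (b && c).
  by rewrite linearMnl /= linearMnr -mulrnA mulnC mulnb.
rewrite {1 2}/comb linearDl /= !linearDr /= !mulMn uu uv vu vv.
by rewrite !comb_scale !comb_add.
Qed.

(** * The eight algebras *)

Local Notation "''e'" := (delta_mx 0 0 : 'rV['F_2]_2).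
Local Notation "''f'" := (delta_mx 0 1 : 'rV['F_2]_2).

Lemma ECC_tablesE (i : 'I_8) :
  tnth ECC_tables i =
  let t := ECC_bits i in
  table2 (comb 'e 'f (sq_fst t)) (comb 'e 'f (prod_fs t))
         (comb 'e 'f (prod_sf t)) (comb 'e 'f (sq_snd t)).
Proof.
rewrite (tnth_nth 0).
by case: i => [[|[|[|[|[|[|[|[|//]]]]]]]] lt_i]; rewrite /comb /= ?addr0 ?add0r.
Qed.

Lemma has_table_ECC (i : 'I_8) :
  has_table ('e : ECC i) ('f : ECC i) (ECC_bits i).
Proof.
by split; rewrite table_algebraE ECC_tablesE mxE.
Qed.

Lemma independent_delta : independent 'e 'f.
Proof.
by split; apply/eqP=> /matrixP/(_ 0); [move/(_ 0) | move/(_ 1) | move/(_ 0)];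
  rewrite !mxE.
Qed.

Lemma dim_ECC (i : 'I_8) : \dim {: ECC i} = 2%N.
Proof. by rewrite dimvf /dim /=. Qed.

Lemma isomorphic_ECC (A : nalgebra 'F_2) (u v : A) (i : 'I_8) :
  \dim {: A} = 2%N -> independent u v -> has_table u v (ECC_bits i) ->
  isomorphic A (ECC i).
Proof.
move=> dimA uv_ind [uu uv vu vv].
apply: (@isomorphic_table_algebra _ A 2 [tuple u; v]).
  exact: independent_basis.
move=> j k.
have comb_coord p :
    comb u v p = \sum_l comb 'e 'f p 0 l *: [tuple u; v]`_l.
  rewrite big_ord_recl big_ord1 /comb !mxE !mulmxnE !mxE /=.
  rewrite !mul0rn addr0 add0r.
  by case: p => [[] []]; rewrite /= ?scale0r ?scale1r.
rewrite ECC_tablesE mxE.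
by case: (unliftP ord0 j) => [j'|] ->; case: (unliftP ord0 k) => [k'|] ->;
   rewrite ?ord1 /= -comb_coord.
Qed.

Lemma ECC_endo_commutative (i : 'I_8) : endo_commutative (ECC i).
Proof.
move=> x y.
have [p ->] := comb_surj (dim_ECC i) independent_delta x.
have [q ->] := comb_surj (dim_ECC i) independent_delta y.
rewrite !(comb_mul (has_table_ECC i)); congr comb.
by case: i {x y} => [[|[|[|[|[|[|[|[|//]]]]]]]] lt_i];
   case: p => [[] []]; case: q => [[] []].
Qed.

Lemma ECC_curled (i : 'I_8) : curled (ECC i).
Proof.
move=> x; have [p ->] := comb_surj (dim_ECC i) independent_delta x.
rewrite !(comb_mul (has_table_ECC i)).
(* The scalar is 1 for an idempotent and 0 for an element of square zero. *)
exists ((bits_mul (ECC_bits i) p p != (false, false))%:R).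
by case: i {x} => [[|[|[|[|[|[|[|[|//]]]]]]]] lt_i]; case: p => [[] []];
   rewrite /comb /= ?scale0r ?scale1r ?addr0 ?add0r.
Qed.

(** * Two numerical invariants *)

Definition left_fixed (i : 'I_8) :=
  [set z : 'rV['F_2]_2 * 'rV['F_2]_2 | (z.1 : ECC i) ** z.2 == z.2].

Definition right_fixed (i : 'I_8) :=
  [set z : 'rV['F_2]_2 * 'rV['F_2]_2 | (z.1 : ECC i) ** z.2 == z.1].

Lemma card_fixed_isomorphic (i j : 'I_8) : isomorphic (ECC i) (ECC j) ->
  #|left_fixed i| = #|left_fixed j| /\ #|right_fixed i| = #|right_fixed j|.
Proof.
case=> phi phi_bij phiM.
pose phi2 (z : 'rV['F_2]_2 * 'rV['F_2]_2) : 'rV['F_2]_2 * 'rV['F_2]_2 :=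
  (phi z.1, phi z.2).
have phi_inj := bij_inj phi_bij.
have phi2_bij : bijective phi2.
  by apply: injF_bij => -[x y] [x' y'] [/phi_inj -> /phi_inj ->].
split.
- rewrite -[RHS](on_card_preimset (onW_bij _ phi2_bij)).
  apply: eq_card => -[x y]; rewrite !inE.
  transitivity (phi ((x : ECC i) ** y) == phi y); last by rewrite phiM.
  exact/esym/inj_eq.
- rewrite -[RHS](on_card_preimset (onW_bij _ phi2_bij)).
  apply: eq_card => -[x y]; rewrite !inE.
  transitivity (phi ((x : ECC i) ** y) == phi x); last by rewrite phiM.
  exact/esym/inj_eq.
Qed.

Definition all_bits : seq (bool * bool) :=
  [seq (a, b) | a <- [:: true; false], b <- [:: true; false]].

Lemma card_pair_comb (P : pred ('rV['F_2]_2 * 'rV['F_2]_2)) :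
  #|[set z | P z]| =
  count (fun r => P (comb 'e 'f r.1, comb 'e 'f r.2))
        [seq (p, q) | p <- all_bits, q <- all_bits].
Proof.
pose g (r : (bool * bool) * (bool * bool)) := (comb 'e 'f r.1, comb 'e 'f r.2).
have comb_inj := comb_inj independent_delta.
have g_bij : bijective g.
  apply: inj_card_bij => [[p q] [p' q'] [/comb_inj -> /comb_inj ->]//|].
  by rewrite !card_prod card_mx card_Fp // card_bool.
rewrite -(on_card_preimset (onW_bij _ g_bij)) cardE size_filter -enumT.
have /permP -> : perm_eq (enum {: (bool * bool) * (bool * bool)})
    [seq (p, q) | p <- all_bits, q <- all_bits].
  by apply: uniq_perm; rewrite ?enum_uniq // => -[[[] []] [[] []]];
    rewrite mem_enum.
by apply: eq_count => r; rewrite !inE.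
Qed.

Lemma card_left_fixed (i : 'I_8) :
  #|left_fixed i| = nth 0%N [:: 4; 6; 9; 5; 10; 6; 9; 7]%N i.
Proof.
rewrite card_pair_comb.
rewrite (@eq_count _ _ (fun r => bits_mul (ECC_bits i) r.1 r.2 == r.2)).
  by case: i => [[|[|[|[|[|[|[|[|//]]]]]]]] lt_i].
move=> r /=; rewrite (comb_mul (has_table_ECC i)).
exact/inj_eq/comb_inj/independent_delta.
Qed.

Lemma card_right_fixed (i : 'I_8) :
  #|right_fixed i| = nth 0%N [:: 4; 6; 5; 9; 6; 10; 9; 7]%N i.
Proof.
rewrite card_pair_comb.
rewrite (@eq_count _ _ (fun r => bits_mul (ECC_bits i) r.1 r.2 == r.1)).
  by case: i => [[|[|[|[|[|[|[|[|//]]]]]]]] lt_i].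
move=> r /=; rewrite (comb_mul (has_table_ECC i)).
exact/inj_eq/comb_inj/independent_delta.
Qed.

(** No two columns of the two lists of cardinals agree. *)
Lemma ECC_isomorphic_inj (i j : 'I_8) : isomorphic (ECC i) (ECC j) -> i = j.
Proof.
case/card_fixed_isomorphic.
rewrite !card_left_fixed !card_right_fixed => eqL eqR.
by apply: val_inj; move: eqL eqR;
   case: i => [[|[|[|[|[|[|[|[|//]]]]]]]] lt_i];
   case: j => [[|[|[|[|[|[|[|[|//]]]]]]]] lt_j].
Qed.

(** * Classification by the number of idempotents *)

Section Classification.

Variable A : nalgebra 'F_2.
Hypotheses (dimA : \dim {: A} = 2%N) (endoA : endo_commutative A)
  (curledA : curled A).

Lemma curled_square (x : A) : x ** x = 0 \/ x ** x = x.
Proof.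
by have [k ->] := curledA x; case: (F2_cases k) => ->;
   rewrite ?scale0r ?scale1r; [left | right].
Qed.

(** Squares being known up to a bit, either mixed product determines
    the other. *)
Lemma mul_polarized (u v : A) :
  v ** u = (u + v) ** (u + v) + (u ** u + (v ** v + u ** v)).
Proof.
rewrite linearDl /= !linearDr /= [X in X + _]addrC -[X in X + _]addrA.
by rewrite [v ** v + (_ + _)]addrCA -addrA addvv addr0.
Qed.

Let classified := exists i : 'I_8, isomorphic A (ECC i).

Let classify (i : 'I_8) (u v : A) :
  independent u v -> has_table u v (ECC_bits i) -> classified.
Proof. by move=> uv_ind uv_table; exists i; apply: isomorphic_ECC uv_table. Qed.

Let combE := (mulr0n, mulr1n, addr0, add0r, addvv, addKv).

(** In the four lemmas that follow, the cases are u v = u + v, u, v, 0, in this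
    order. Here the product is alternating, so its value on any basis is the
    same vector w = u v; when w is not zero, a basis with w in second place
    has the table of ECC 1. *)
Lemma classify_no_idempotent (u v : A) : independent u v ->
  u ** u = 0 -> v ** v = 0 -> (u + v) ** (u + v) = 0 -> classified.
Proof.
move=> uv_ind uu vv ss.
have vu := mul_polarized u v; rewrite uu vv ss !combE in vu.
have vu_ind := independent_swap uv_ind.
have us_ind := independent_add uv_ind.
have [[[] []] uv] := comb_surj dimA uv_ind (u ** v);
  rewrite /comb /= !combE in uv; rewrite uv in vu.
- apply: (@classify (@Ordinal 8 1 isT) u (u + v)) => //.
  by split; rewrite /comb /= ?linearDl /= ?linearDr /= ?uu ?uv ?vu ?combE.
- apply: (@classify (@Ordinal 8 1 isT) v u) => //.
  by split; rewrite /comb /= ?uu ?uv ?vu ?vv ?combE.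
- apply: (@classify (@Ordinal 8 1 isT) u v) => //.
  by split; rewrite /comb /= ?uu ?uv ?vu ?vv ?combE.
- apply: (@classify (@Ordinal 8 0 isT) u v) => //.
  by split; rewrite /comb /= ?uu ?uv ?vu ?vv ?combE.
Qed.

(** Endo-commutativity makes (u v)^2 and (v u)^2 vanish; neither product can be
    the idempotent u + v; as their sum is u + v, they are u and v in one of the
    two orders. *)
Lemma classify_one_idempotent (u v : A) : independent u v ->
  u ** u = 0 -> v ** v = 0 -> (u + v) ** (u + v) = u + v -> classified.
Proof.
move=> uv_ind uu vv ss.
have vu := mul_polarized u v; rewrite uu vv ss !combE in vu.
have endo_uv := endoA u v; have endo_vu := endoA v u.
rewrite uu vv linear0r in endo_uv endo_vu.
have [_ _ /eqP s_neq0] := uv_ind.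
have [[[] []] uv] := comb_surj dimA uv_ind (u ** v);
  rewrite /comb /= !combE in uv; rewrite uv ?combE in vu.
- by case: s_neq0; rewrite endo_uv uv ss.
- apply: (@classify (@Ordinal 8 3 isT) u v) => //.
  by split; rewrite /comb /= ?uu ?uv ?vu ?vv ?combE // addrAC !combE.
- apply: (@classify (@Ordinal 8 2 isT) u v) => //.
  by split; rewrite /comb /= ?uu ?uv ?vu ?vv ?combE // -addrA !combE.
- by case: s_neq0; rewrite endo_vu vu ss.
Qed.

(** Here u v + v u = v, and (u v)^2 = 0 forces u v to be v or 0: one of u v and
    v u is v and the other vanishes. *)
Lemma classify_two_idempotents (u v : A) : independent u v ->
  u ** u = u -> v ** v = 0 -> (u + v) ** (u + v) = u + v -> classified.
Proof.
move=> uv_ind uu vv ss.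
have vu := mul_polarized u v.
rewrite uu vv ss [u + v]addrC -addrA !combE in vu.
have endo_uv := endoA u v; rewrite vv linear0r in endo_uv.
have [/eqP u_neq0 _ /eqP s_neq0] := uv_ind.
have [[[] []] uv] := comb_surj dimA uv_ind (u ** v);
  rewrite /comb /= !combE in uv; rewrite uv ?combE in vu.
- by case: s_neq0; rewrite endo_uv uv ss.
- by case: u_neq0; rewrite endo_uv uv uu.
- apply: (@classify (@Ordinal 8 4 isT) u v) => //.
  by split; rewrite /comb /= ?uu ?uv ?vu ?vv ?combE.
- apply: (@classify (@Ordinal 8 5 isT) u v) => //.
  by split; rewrite /comb /= ?uu ?uv ?vu ?vv ?combE.
Qed.

(** The product is commutative. When u v = u, idempotence of u gives
    u (u + v) = 0, and when u v = v, likewise v (u + v) = 0; an orthogonal pair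
    of idempotents is a basis with the table of ECC 6. *)
Lemma classify_all_idempotent (u v : A) : independent u v ->
  u ** u = u -> v ** v = v -> (u + v) ** (u + v) = u + v -> classified.
Proof.
move=> uv_ind uu vv ss.
have vu := mul_polarized u v.
rewrite uu vv ss -addrA [v + (u + _)]addrCA !combE in vu.
have us_ind := independent_add uv_ind.
have vs_ind := independent_add (independent_swap uv_ind).
have [[[] []] uv] := comb_surj dimA uv_ind (u ** v);
  rewrite /comb /= !combE in uv; rewrite uv in vu.
- apply: (@classify (@Ordinal 8 7 isT) u v) => //.
  by split; rewrite /comb /= ?uu ?uv ?vu ?vv ?combE.
- apply: (@classify (@Ordinal 8 6 isT) u (u + v)) => //.
  by split; rewrite /comb /= ?ss ?linearDl /= ?linearDr /= ?uu ?uv ?vu ?combE.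
- apply: (@classify (@Ordinal 8 6 isT) v (v + u)) => //.
  by split; rewrite /comb /= ?[v + u]addrC ?ss ?linearDl /= ?linearDr /=
       ?vv ?uv ?vu ?combE.
- apply: (@classify (@Ordinal 8 6 isT) u v) => //.
  by split; rewrite /comb /= ?uu ?uv ?vu ?vv ?combE.
Qed.

Lemma classify_curled : classified.
Proof.
have [u [v uv_ind]] := exists_independent dimA.
have vu_ind := independent_swap uv_ind.
have us_ind := independent_add uv_ind.
have vs_ind := independent_add vu_ind; rewrite [v + u]addrC in vs_ind.
have usE : u + (u + v) = v by rewrite addKv.
have vsE : v + (u + v) = u by rewrite addrCA addvv addr0.
(* The basis is reordered so that a lone idempotent comes as the sum of the two
   basis vectors, and a lone vector of square zero as the second of them. *)
have [uu | uu] := curled_square u; have [vv | vv] := curled_square v;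
  have [ss | ss] := curled_square (u + v).
- exact: (classify_no_idempotent uv_ind).
- exact: (classify_one_idempotent uv_ind).
- by apply: (classify_one_idempotent us_ind); rewrite ?usE.
- by apply: (classify_two_idempotents vu_ind); rewrite // [v + u]addrC.
- by apply: (classify_one_idempotent vs_ind); rewrite ?vsE.
- exact: (classify_two_idempotents uv_ind).
- by apply: (classify_two_idempotents us_ind); rewrite ?usE.
- exact: (classify_all_idempotent uv_ind).
Qed.

End Classification.

Theorem theorem1 :
  [/\ forall i : 'I_8,
        [/\ \dim {: ECC i} = 2%N, endo_commutative (ECC i) & curled (ECC i)],
      forall i j : 'I_8, isomorphic (ECC i) (ECC j) -> i = j
    & forall A : nalgebra 'F_2,
        \dim {: A} = 2%N -> endo_commutative A -> curled A ->
        exists i : 'I_8, isomorphic A (ECC i)].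
Proof.
split; [move=> i; split | exact: ECC_isomorphic_inj | exact: classify_curled].
- exact: dim_ECC.
- exact: ECC_endo_commutative.
- exact: ECC_curled.
Qed.
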